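(* Let $k$ be a field of characteristic $0$ and let $\Theta$ be the variety of all alternative linear algebras over $k$. Let $F=F(x_1,x_2)$ be the free algebra of $\Theta$ on two free generators, let $I$ be the verbal ideal of $F$ generated by the identity $x_1x_2^2=0$, i.e. the two-sided ideal of $F$ generated by $\{\alpha(x_1x_2^2)\mid\alpha\in\mathrm{End}\,F\}$, and let $H=F/I$. Let $H^{\ast}_W$ be the algebra with the same underlying $k$-vector space as $H$ but with the opposite multiplication $h_1\times h_2=h_2h_1$. Then $H$ and $H^{\ast}_W$ are not geometrically equivalent.
   Context: A linear algebra over $k$ is a $k$-vector space with a $k$-bilinear multiplication (not assumed associative, commutative or unital); homomorphisms are $k$-linear multiplicative maps. A linear algebra is alternative if it satisfies $(x_1x_1)x_2=x_1(x_1x_2)$ and $x_2(x_1x_1)=(x_2x_1)x_1$. Let $X_0=\{x_1,x_2,\ldots\}$ be a countable set; for finite $X\subset X_0$ let $F(X)$ be the free algebra of $\Theta$ on $X$. For $H\in\Theta$ and $S\subseteq F(X)$ put $S''_H=\bigcap\{\ker\mu\mid\mu\in\mathrm{Hom}(F(X),H),\ S\subseteq\ker\mu\}$, where $\ker\mu$ is the ideal $\mu^{-1}(0)$. Algebras $H_1,H_2\in\Theta$ are geometrically equivalent if $S''_{H_1}=S''_{H_2}$ for every finite $X\subset X_0$ and every $S\subseteq F(X)$. *)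

(* Defs.v *)
From HB Require Import structures.
From mathcomp Require Import all_boot all_order all_algebra.
From mathcomp Require Import generic_quotient ring_quotient finmap.
From mathcomp Require Import boolp classical_sets.

Set Implicit Arguments.
Unset Strict Implicit.
Unset Printing Implicit Defensive.

Import GRing.Theory.
Local Open Scope ring_scope.
Local Open Scope classical_set_scope.
Local Open Scope quotient_scope.

Reserved Notation "x ** y" (at level 40, left associativity).

(* The multiplication is only bilinear: MathComp's algebras are associative
   and unital, so they cannot be used here. *)
HB.mixin Record Lmodule_isLinAlg (k : fieldType) A of GRing.Lmodule k A := {
  amul : A -> A -> A;
  amulDl : left_distributive amul +%R;
  amulDr : right_distributive amul +%R;
  amulZl : forall (c : k) (x y : A), amul (c *: x) y = c *: amul x y;
  amulZr : forall (c : k) (x y : A), amul x (c *: y) = c *: amul x y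
}.

#[short(type="linAlgType")]
HB.structure Definition LinAlg (k : fieldType) :=
  {A of GRing.Lmodule k A & Lmodule_isLinAlg k A}.

Notation "x ** y" := (amul x y) : ring_scope.

HB.mixin Record LinAlg_isAlternative (k : fieldType) A of LinAlg k A := {
  alternativel : forall x y : A, (x ** x) ** y = x ** (x ** y);
  alternativer : forall x y : A, y ** (x ** x) = (y ** x) ** x
}.

#[short(type="altAlgType")]
HB.structure Definition AltAlg (k : fieldType) :=
  {A of LinAlg k A & LinAlg_isAlternative k A}.

HB.mixin Record isAmulMorphism (k : fieldType) (A B : linAlgType k)
    (f : A -> B) := {
  hom_amul : {morph f : x y / x ** y}
}.

#[short(type="linAlgHom")]
HB.structure Definition LinAlgHom (k : fieldType) (A B : linAlgType k) :=
  {f of isAmulMorphism k A B f & @GRing.Linear k A B *:%R f}.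

(* Ideals are required to be k-subspaces: this is not automatic in a non-unital
   algebra. *)
Definition two_sided_ideal (k : fieldType) (A : linAlgType k) (J : {pred A}) :
    Prop :=
  [/\ submod_closed J,
      forall a x, x \in J -> a ** x \in J &
      forall a x, x \in J -> x ** a \in J].

Record linAlgIdeal (k : fieldType) (A : linAlgType k) := LinAlgIdeal {
  ideal_pred :> {pred A};
  ideal_closed : two_sided_ideal ideal_pred
}.

Section IdealTheory.
Variables (k : fieldType) (A : linAlgType k) (J : linAlgIdeal A).

Lemma ideal_submod : submod_closed (ideal_pred J).
Proof. by case: (ideal_closed J). Qed.

Lemma idealMl a x : x \in J -> a ** x \in J.
Proof. by case: (ideal_closed J) => _ + _; apply. Qed.

Lemma idealMr a x : x \in J -> x ** a \in J.
Proof. by case: (ideal_closed J) => _ _; apply. Qed.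

HB.instance Definition _ :=
  GRing.isSubmodClosed.Build k A (ideal_pred J) ideal_submod.
End IdealTheory.

Section Amul.
Variables (k : fieldType) (A : linAlgType k).
Implicit Types x y z : A.

Lemma amulBl x y z : (x - y) ** z = x ** z - y ** z.
Proof. by rewrite amulDl -scaleN1r amulZl scaleN1r. Qed.

Lemma amulBr x y z : z ** (x - y) = z ** x - z ** y.
Proof. by rewrite amulDr -scaleN1r amulZr scaleN1r. Qed.
End Amul.

(* H^*_W: the same vector space as A, with (x, y) |-> y ** x as the product. *)
Definition oppalg (k : fieldType) (A : linAlgType k) : Type := A.

Section OppAlg.
Variables (k : fieldType) (A : linAlgType k).

HB.instance Definition _ := GRing.Lmodule.copy (oppalg A) A.

Definition oppmul (x y : oppalg A) : oppalg A := (y : A) ** (x : A).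

Lemma oppmulDl : left_distributive oppmul +%R.
Proof. by move=> x y z; apply: amulDr. Qed.

Lemma oppmulDr : right_distributive oppmul +%R.
Proof. by move=> x y z; apply: amulDl. Qed.

Lemma oppmulZl (c : k) (x y : oppalg A) : oppmul (c *: x) y = c *: oppmul x y.
Proof. exact: amulZr. Qed.

Lemma oppmulZr (c : k) (x y : oppalg A) : oppmul x (c *: y) = c *: oppmul x y.
Proof. exact: amulZl. Qed.

HB.instance Definition _ := Lmodule_isLinAlg.Build k (oppalg A)
  oppmulDl oppmulDr oppmulZl oppmulZr.
End OppAlg.

Section OppAlt.
Variables (k : fieldType) (A : altAlgType k).

Lemma oppalg_alternativel (x y : oppalg A) : (x ** x) ** y = x ** (x ** y).
Proof. exact: alternativer. Qed.

Lemma oppalg_alternativer (x y : oppalg A) : y ** (x ** x) = (y ** x) ** x.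
Proof. exact: alternativel. Qed.

HB.instance Definition _ := LinAlg_isAlternative.Build k (oppalg A)
  oppalg_alternativel oppalg_alternativer.
End OppAlt.

(* The additive group is MathComp's {quot J}. *)

Definition quotalg (k : fieldType) (A : linAlgType k) (J : linAlgIdeal A) :
  Type := Quotient.quot (ideal_pred J).

Section QuotAlg.
Variables (k : fieldType) (A : linAlgType k) (J : linAlgIdeal A).
Local Notation Q := (quotalg J).

HB.instance Definition _ := GRing.Zmodule.copy Q (Quotient.quot (ideal_pred J)).

Definition quot_pi (x : A) : Q := \pi_(Quotient.quot (ideal_pred J)) x.

Lemma quot_pi_eq (x y : A) : quot_pi x = quot_pi y <-> x - y \in J.
Proof. by rewrite (Quotient.idealrBE (ideal_pred J)) (rwP eqP). Qed.

Definition quot_repr (u : Q) : A := repr (u : Quotient.quot (ideal_pred J)).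

Lemma quot_reprK : cancel quot_repr quot_pi.
Proof. by move=> u; apply: reprK. Qed.

Lemma quot_repr_pi x : quot_repr (quot_pi x) - x \in J.
Proof. by apply/quot_pi_eq; rewrite quot_reprK. Qed.

Lemma quot_piD : {morph quot_pi : x y / x + y}.
Proof. by move=> x y; apply: Quotient.pi_add. Qed.

Definition quot_scale (c : k) (u : Q) : Q := quot_pi (c *: quot_repr u).
Definition quot_mul (u v : Q) : Q := quot_pi (quot_repr u ** quot_repr v).

Lemma quot_piZ_subproof c x : quot_pi (c *: x) = quot_scale c (quot_pi x).
Proof.
by apply/esym/quot_pi_eq; rewrite -scalerBr rpredZ ?quot_repr_pi.
Qed.

Lemma quot_piM_subproof x y :
  quot_pi (x ** y) = quot_mul (quot_pi x) (quot_pi y).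
Proof.
apply/esym/quot_pi_eq; set x' := quot_repr _; set y' := quot_repr _.
have -> : x' ** y' - x ** y = (x' - x) ** y' + x ** (y' - y).
  by rewrite amulBl amulBr addrA subrK.
by rewrite rpredD //; [apply: idealMr|apply: idealMl];
  apply: quot_repr_pi.
Qed.

Lemma quot_scaleA a b u : quot_scale a (quot_scale b u) = quot_scale (a * b) u.
Proof.
by rewrite -(quot_reprK u) -!quot_piZ_subproof scalerA.
Qed.

Lemma quot_scale1 : left_id 1 quot_scale.
Proof. by move=> u; rewrite -(quot_reprK u) -quot_piZ_subproof scale1r. Qed.

Lemma quot_scaleDr : right_distributive quot_scale +%R.
Proof.
move=> c u v; rewrite -(quot_reprK u) -(quot_reprK v).
by rewrite -!(quot_piZ_subproof, quot_piD) scalerDr.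
Qed.

Lemma quot_scaleDl u : {morph quot_scale^~ u : a b / a + b}.
Proof.
move=> a b; rewrite -(quot_reprK u).
by rewrite -!(quot_piZ_subproof, quot_piD) scalerDl.
Qed.

HB.instance Definition _ := GRing.Zmodule_isLmodule.Build k Q
  quot_scaleA quot_scale1 quot_scaleDr quot_scaleDl.

Lemma quot_piZ : scalable quot_pi.
Proof. by move=> c x; rewrite quot_piZ_subproof. Qed.

Lemma quot_mulDl : left_distributive quot_mul +%R.
Proof.
move=> u v w; rewrite -(quot_reprK u) -(quot_reprK v) -(quot_reprK w).
by rewrite -!(quot_piM_subproof, quot_piD) amulDl.
Qed.

Lemma quot_mulDr : right_distributive quot_mul +%R.
Proof.
move=> u v w; rewrite -(quot_reprK u) -(quot_reprK v) -(quot_reprK w).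
by rewrite -!(quot_piM_subproof, quot_piD) amulDr.
Qed.

Lemma quot_mulZl (c : k) (u v : Q) : quot_mul (c *: u) v = c *: quot_mul u v.
Proof.
rewrite -(quot_reprK u) -(quot_reprK v).
by rewrite -quot_piZ -!quot_piM_subproof -quot_piZ amulZl.
Qed.

Lemma quot_mulZr (c : k) (u v : Q) : quot_mul u (c *: v) = c *: quot_mul u v.
Proof.
rewrite -(quot_reprK u) -(quot_reprK v).
by rewrite -quot_piZ -!quot_piM_subproof -quot_piZ amulZr.
Qed.

HB.instance Definition _ := Lmodule_isLinAlg.Build k Q
  quot_mulDl quot_mulDr quot_mulZl quot_mulZr.

Lemma quot_piB : zmod_morphism quot_pi.
Proof.
move=> x y; rewrite quot_piD; congr (_ + _).
by rewrite -scaleN1r quot_piZ_subproof; apply: scaleN1r.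
Qed.

Lemma quot_piM : {morph quot_pi : x y / x ** y}.
Proof. by move=> x y; rewrite quot_piM_subproof. Qed.

HB.instance Definition _ := GRing.isZmodMorphism.Build A Q quot_pi quot_piB.
HB.instance Definition _ := GRing.isScalable.Build k A Q *:%R quot_pi quot_piZ.
HB.instance Definition _ := isAmulMorphism.Build k A Q quot_pi quot_piM.
End QuotAlg.

Section QuotAlt.
Variables (k : fieldType) (A : altAlgType k) (J : linAlgIdeal A).

Lemma quotalg_alternativel (x y : quotalg J) : (x ** x) ** y = x ** (x ** y).
Proof.
by rewrite -(quot_reprK x) -(quot_reprK y) -!quot_piM alternativel.
Qed.

Lemma quotalg_alternativer (x y : quotalg J) : y ** (x ** x) = (y ** x) ** x.
Proof.
by rewrite -(quot_reprK x) -(quot_reprK y) -!quot_piM alternativer.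
Qed.

HB.instance Definition _ := LinAlg_isAlternative.Build k (quotalg J)
  quotalg_alternativel quotalg_alternativer.
End QuotAlt.

Section GeneratedIdeal.
Variables (k : fieldType) (A : linAlgType k) (S : set A).

Definition ideal_gen_pred : {pred A} :=
  fun x => `[< forall J : linAlgIdeal A, S `<=` [set` J] -> x \in J >].

Lemma ideal_gen_predP x :
  reflect (forall J : linAlgIdeal A, S `<=` [set` J] -> x \in J)
          (x \in ideal_gen_pred).
Proof. exact: asboolP. Qed.

Lemma ideal_gen_closed : two_sided_ideal ideal_gen_pred.
Proof.
split=> [|a x /ideal_gen_predP xI|a x /ideal_gen_predP xI]; first split.
- by apply/ideal_gen_predP => J SJ; apply: rpred0.
- move=> c x y /ideal_gen_predP xI /ideal_gen_predP yI.
  by apply/ideal_gen_predP => J SJ; rewrite rpredD ?rpredZ ?xI ?yI.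
- by apply/ideal_gen_predP => J SJ; rewrite idealMl ?xI.
- by apply/ideal_gen_predP => J SJ; rewrite idealMr ?xI.
Qed.

Definition ideal_gen : linAlgIdeal A := LinAlgIdeal ideal_gen_closed.

Lemma sub_ideal_gen : S `<=` [set` ideal_gen].
Proof. by move=> x Sx; apply/ideal_gen_predP => J; apply. Qed.
End GeneratedIdeal.

(* The verbal ideal of the identity w = 0: generated by all values of w under the
   endomorphisms of A. *)
Definition verbal_ideal (k : fieldType) (A : linAlgType k) (w : A) :
    linAlgIdeal A :=
  ideal_gen [set alpha w | alpha in [set: linAlgHom A A]].

(* The free alternative algebra on a type X of generators: terms modulo
   the equations derivable from the axioms of alternative algebras.  Its
   universal property is proved below (free_lift, free_lift_gen, free_hom_eq). *)

Inductive term (k X : Type) : Type :=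
  | TVar of X
  | TZero
  | TOpp of term k X
  | TAdd of term k X & term k X
  | TScale of k & term k X
  | TMul of term k X & term k X.

Arguments TVar {k X}.
Arguments TZero {k X}.

Inductive teq (k : fieldType) (X : Type) : term k X -> term k X -> Prop :=
  | teq_refl s : teq s s
  | teq_sym s t : teq s t -> teq t s
  | teq_trans s t u : teq s t -> teq t u -> teq s u
  | teq_opp s s' : teq s s' -> teq (TOpp s) (TOpp s')
  | teq_add s s' t t' : teq s s' -> teq t t' -> teq (TAdd s t) (TAdd s' t')
  | teq_scale c s s' : teq s s' -> teq (TScale c s) (TScale c s')
  | teq_mul s s' t t' : teq s s' -> teq t t' -> teq (TMul s t) (TMul s' t')
  | teq_addA s t u : teq (TAdd s (TAdd t u)) (TAdd (TAdd s t) u)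
  | teq_addC s t : teq (TAdd s t) (TAdd t s)
  | teq_add0 s : teq (TAdd TZero s) s
  | teq_addN s : teq (TAdd (TOpp s) s) TZero
  | teq_scaleA a b s : teq (TScale a (TScale b s)) (TScale (a * b) s)
  | teq_scale1 s : teq (TScale 1 s) s
  | teq_scaleDr c s t :
      teq (TScale c (TAdd s t)) (TAdd (TScale c s) (TScale c t))
  | teq_scaleDl a b s :
      teq (TScale (a + b) s) (TAdd (TScale a s) (TScale b s))
  | teq_mulDl s t u : teq (TMul (TAdd s t) u) (TAdd (TMul s u) (TMul t u))
  | teq_mulDr s t u : teq (TMul s (TAdd t u)) (TAdd (TMul s t) (TMul s u))
  | teq_mulZl c s t : teq (TMul (TScale c s) t) (TScale c (TMul s t))
  | teq_mulZr c s t : teq (TMul s (TScale c t)) (TScale c (TMul s t))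
  | teq_altl s t : teq (TMul (TMul s s) t) (TMul s (TMul s t))
  | teq_altr s t : teq (TMul t (TMul s s)) (TMul (TMul t s) s).

Section FreeAlt.
Variables (k : fieldType) (X : Type).
Local Notation T := (term k X).

HB.instance Definition _ := gen_eqMixin T.
HB.instance Definition _ := gen_choiceMixin T.

Definition teqb (s t : T) : bool := `[< teq s t >].

Lemma teqb_equiv : equiv_class_of teqb.
Proof.
split=> [s|s t|t s u].
- exact/asboolP/teq_refl.
- by apply/asboolP/asboolP; apply: teq_sym.
- move=> /asboolP st /asboolP tu; apply/asboolP; exact: teq_trans st tu.
Qed.

Canonical teqb_equiv_rel := EquivRelPack teqb_equiv.

Definition freealt : Type := {eq_quot teqb}.
HB.instance Definition _ := Choice.copy freealt {eq_quot teqb}.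

Definition cls (t : T) : freealt := \pi_({eq_quot teqb}) t.
Definition rep (u : freealt) : T := repr (u : {eq_quot teqb}).

Lemma clsP s t : cls s = cls t <-> teq s t.
Proof.
split=> [/eqmodP/asboolP //|st]; exact/eqmodP/asboolP.
Qed.

Lemma repK : cancel rep cls.
Proof. by move=> u; apply: reprK. Qed.

Lemma rep_cls t : teq (rep (cls t)) t.
Proof. by apply/clsP; rewrite repK. Qed.

Definition fopp (u : freealt) := cls (TOpp (rep u)).
Definition fadd (u v : freealt) := cls (TAdd (rep u) (rep v)).
Definition fscale (c : k) (u : freealt) := cls (TScale c (rep u)).
Definition fmul (u v : freealt) := cls (TMul (rep u) (rep v)).

Lemma fopp_cls s : fopp (cls s) = cls (TOpp s).
Proof. exact/clsP/teq_opp/rep_cls. Qed.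

Lemma fadd_cls s t : fadd (cls s) (cls t) = cls (TAdd s t).
Proof. by apply/clsP/teq_add; apply: rep_cls. Qed.

Lemma fscale_cls c s : fscale c (cls s) = cls (TScale c s).
Proof. exact/clsP/teq_scale/rep_cls. Qed.

Lemma fmul_cls s t : fmul (cls s) (cls t) = cls (TMul s t).
Proof. by apply/clsP/teq_mul; apply: rep_cls. Qed.

Let clsE := (fopp_cls, fadd_cls, fscale_cls, fmul_cls).

Lemma faddA : associative fadd.
Proof.
move=> u v w; rewrite -(repK u) -(repK v) -(repK w) !clsE.
exact/clsP/teq_addA.
Qed.

Lemma faddC : commutative fadd.
Proof. by move=> u v; rewrite -(repK u) -(repK v) !clsE; apply/clsP/teq_addC. Qed.

Lemma fadd0 : left_id (cls TZero) fadd.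
Proof. by move=> u; rewrite -(repK u) !clsE; apply/clsP/teq_add0. Qed.

Lemma faddN : left_inverse (cls TZero) fopp fadd.
Proof. by move=> u; rewrite -(repK u) !clsE; apply/clsP/teq_addN. Qed.

HB.instance Definition _ := GRing.isZmodule.Build freealt faddA faddC fadd0 faddN.

Lemma fscaleA a b u : fscale a (fscale b u) = fscale (a * b) u.
Proof. by rewrite -(repK u) !clsE; apply/clsP/teq_scaleA. Qed.

Lemma fscale1 : left_id 1 fscale.
Proof. by move=> u; rewrite -(repK u) !clsE; apply/clsP/teq_scale1. Qed.

Lemma fscaleDr : right_distributive fscale fadd.
Proof.
by move=> c u v; rewrite -(repK u) -(repK v) !clsE; apply/clsP/teq_scaleDr.
Qed.

Lemma fscaleDl u : {morph fscale^~ u : a b / a + b >-> fadd a b}.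
Proof. by move=> a b; rewrite -(repK u) !clsE; apply/clsP/teq_scaleDl. Qed.

HB.instance Definition _ := GRing.Zmodule_isLmodule.Build k freealt
  fscaleA fscale1 fscaleDr fscaleDl.

Lemma fmulDl : left_distributive fmul fadd.
Proof.
move=> u v w; rewrite -(repK u) -(repK v) -(repK w) !clsE.
exact/clsP/teq_mulDl.
Qed.

Lemma fmulDr : right_distributive fmul fadd.
Proof.
move=> u v w; rewrite -(repK u) -(repK v) -(repK w) !clsE.
exact/clsP/teq_mulDr.
Qed.

Lemma fmulZl c u v : fmul (fscale c u) v = fscale c (fmul u v).
Proof. by rewrite -(repK u) -(repK v) !clsE; apply/clsP/teq_mulZl. Qed.

Lemma fmulZr c u v : fmul u (fscale c v) = fscale c (fmul u v).
Proof. by rewrite -(repK u) -(repK v) !clsE; apply/clsP/teq_mulZr. Qed.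

HB.instance Definition _ := Lmodule_isLinAlg.Build k freealt
  fmulDl fmulDr fmulZl fmulZr.

Lemma fmul_altl u v : fmul (fmul u u) v = fmul u (fmul u v).
Proof. by rewrite -(repK u) -(repK v) !clsE; apply/clsP/teq_altl. Qed.

Lemma fmul_altr u v : fmul v (fmul u u) = fmul (fmul v u) u.
Proof. by rewrite -(repK u) -(repK v) !clsE; apply/clsP/teq_altr. Qed.

HB.instance Definition _ := LinAlg_isAlternative.Build k freealt
  fmul_altl fmul_altr.

Definition gen (x : X) : freealt := cls (TVar x).

Section Lift.
Variables (A : altAlgType k) (h : X -> A).

Fixpoint teval (t : T) : A :=
  match t with
  | TVar x => h x
  | TZero => 0
  | TOpp s => - teval s
  | TAdd s u => teval s + teval u
  | TScale c s => c *: teval s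
  | TMul s u => teval s ** teval u
  end.

Lemma teval_eq s t : teq s t -> teval s = teval t.
Proof.
elim=> //=; try by move=> *; congruence.
- by move=> *; rewrite addrA.
- by move=> *; rewrite addrC.
- by move=> *; rewrite add0r.
- by move=> *; rewrite addNr.
- by move=> *; rewrite scalerA.
- by move=> *; rewrite scale1r.
- by move=> *; rewrite scalerDr.
- by move=> *; rewrite scalerDl.
- by move=> *; rewrite amulDl.
- by move=> *; rewrite amulDr.
- by move=> *; rewrite amulZl.
- by move=> *; rewrite amulZr.
- by move=> *; rewrite alternativel.
- by move=> *; rewrite alternativer.
Qed.

Definition free_lift (u : freealt) : A := teval (rep u).

Lemma free_lift_cls t : free_lift (cls t) = teval t.
Proof. exact/teval_eq/rep_cls. Qed.

Lemma free_lift_zmod : zmod_morphism free_lift.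
Proof.
move=> u v; rewrite -(repK u) -(repK v).
by rewrite [- cls _]fopp_cls [cls _ + cls _]fadd_cls !free_lift_cls.
Qed.

Lemma free_lift_scalable : scalable free_lift.
Proof.
by move=> c u; rewrite -(repK u) [_ *: _]fscale_cls !free_lift_cls.
Qed.

Lemma free_liftM : {morph free_lift : u v / u ** v}.
Proof.
move=> u v; rewrite -(repK u) -(repK v).
by rewrite [_ ** _]fmul_cls !free_lift_cls.
Qed.

HB.instance Definition _ :=
  GRing.isZmodMorphism.Build freealt A free_lift free_lift_zmod.
HB.instance Definition _ :=
  GRing.isScalable.Build k freealt A *:%R free_lift free_lift_scalable.
HB.instance Definition _ := isAmulMorphism.Build k freealt A free_lift free_liftM.

Lemma free_lift_gen x : free_lift (gen x) = h x.
Proof. exact: free_lift_cls. Qed.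
End Lift.

Lemma free_hom_eq (A : linAlgType k) (f g : linAlgHom freealt A) :
  (forall x, f (gen x) = g (gen x)) -> f =1 g.
Proof.
move=> fg u; rewrite -(repK u).
elim: (rep u) => //= [|s IH|s IHs t IHt|c s IH|s IHs t IHt].
- by rewrite -[cls _]/(0 : freealt) !raddf0.
- by rewrite -fopp_cls -[fopp _]/(- _ : freealt) !raddfN /= IH.
- by rewrite -fadd_cls -[fadd _ _]/(_ + _ : freealt) !raddfD /= IHs IHt.
- by rewrite -fscale_cls -[fscale _ _]/(_ *: _ : freealt) !linearZ /= IH.
- by rewrite -fmul_cls -[fmul _ _]/(_ ** _ : freealt) !hom_amul IHs IHt.
Qed.
End FreeAlt.

Arguments gen {k X} x.

(* The countable set of variables {x_1, x_2, ...} is nat, the index i standing for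
   x_(i+1); FX X is the free algebra on the elements of X. *)
Definition FX (k : fieldType) (X : {fset nat}) : altAlgType k := freealt k X.
Arguments FX : clear implicits.

Definition hker (k : fieldType) (A B : linAlgType k) (mu : linAlgHom A B) :
  set A := mu @^-1` [set 0].

(* S''_H *)
Definition galois_closure (k : fieldType) (H : altAlgType k) (X : {fset nat})
    (S : set (FX k X)) : set (FX k X) :=
  \bigcap_(mu in [set mu : linAlgHom (FX k X) H | S `<=` hker mu]) hker mu.

Definition geom_equiv (k : fieldType) (H1 H2 : altAlgType k) : Prop :=
  forall (X : {fset nat}) (S : set (FX k X)),
    galois_closure H1 S = galois_closure H2 S.

Definition X12 : {fset nat} := [fset 0%N; 1%N]%fset.

Definition x1 (k : fieldType) : FX k X12 := gen [` fset21 0%N 1%N]%fset.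
Definition x2 (k : fieldType) : FX k X12 := gen [` fset22 0%N 1%N]%fset.

Definition verbalI (k : fieldType) : linAlgIdeal (FX k X12) :=
  verbal_ideal (x1 k ** (x2 k ** x2 k)).

Definition algH (k : fieldType) : altAlgType k := quotalg (verbalI k).

(* Main.v *)
(* In H every product a (b b) vanishes, so x1 (x2 x2) lies in the H-closure of
   the empty set.  Were it also in the closure taken in the opposite algebra,
   (x2 x2) x1 would vanish in H, that is, lie in the verbal ideal.  It does not:
   there is a nilpotent associative algebra satisfying a (b b) = 0 but not
   (b b) a = 0. *)
From HB Require Import structures.
Require Import Defs.
From mathcomp Require Import all_boot all_order all_algebra.
From mathcomp Require Import finmap classical_sets ring.

Set Implicit Arguments.
Unset Strict Implicit.
Unset Printing Implicit Defensive.

Import GRing.Theory.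

Section Witness.
Variable k : fieldType.
Local Open Scope ring_scope.

(* Coordinates (y, x, yy, xy, yx, yyx) of the associative algebra on x, y with
   xx = 0, all products of degree 4 zero, and in degree 3 only yyx = - yxy
   nonzero: these are the relations that a (bc + cb) = 0 forces. *)
Definition witness : Type := (k^o * k^o * k^o * k^o * k^o * k^o)%type.

HB.instance Definition _ :=
  GRing.Lmodule.copy witness (k^o * k^o * k^o * k^o * k^o * k^o)%type.

(** The minus signs come from [yxy = - yyx], a monomial reached both as [yx] times [y] and as [y]
    times [xy]. *)
Definition witness_mul (u v : witness) : witness :=
  let: (y, x, yy, xy, yx, _) := u in
  let: (y', x', yy', xy', yx', _) := v in
  (0, 0, y * y', x * y', y * x', yy * x' - yx * y' + y * yx' - y * xy').

Let addE (a b c d e f a' b' c' d' e' f' : k) :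
  (a, b, c, d, e, f) + (a', b', c', d', e', f') =
  (a + a', b + b', c + c', d + d', e + e', f + f') :> witness.
Proof. by []. Qed.

Let scaleE (r a b c d e f : k) :
  r *: ((a, b, c, d, e, f) : witness) =
  (r * a, r * b, r * c, r * d, r * e, r * f).
Proof. by []. Qed.

Lemma witness_mulDl : left_distributive witness_mul +%R.
Proof.
move=> [[[[[a b] c] d] e] f] [[[[[a1 b1] c1] d1] e1] f1].
move=> [[[[[a2 b2] c2] d2] e2] f2]; rewrite addE /witness_mul addE.
by do !congr pair; ring.
Qed.

Lemma witness_mulDr : right_distributive witness_mul +%R.
Proof.
move=> [[[[[a b] c] d] e] f] [[[[[a1 b1] c1] d1] e1] f1].
move=> [[[[[a2 b2] c2] d2] e2] f2]; rewrite addE /witness_mul addE.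
by do !congr pair; ring.
Qed.

Lemma witness_mulZl (r : k) (u v : witness) :
  witness_mul (r *: u) v = r *: witness_mul u v.
Proof.
case: u v => [[[[[a b] c] d] e] f] [[[[[a1 b1] c1] d1] e1] f1].
by rewrite scaleE /witness_mul scaleE; do !congr pair; ring.
Qed.

Lemma witness_mulZr (r : k) (u v : witness) :
  witness_mul u (r *: v) = r *: witness_mul u v.
Proof.
case: u v => [[[[[a b] c] d] e] f] [[[[[a1 b1] c1] d1] e1] f1].
by rewrite scaleE /witness_mul scaleE; do !congr pair; ring.
Qed.

HB.instance Definition _ := Lmodule_isLinAlg.Build k witness
  witness_mulDl witness_mulDr witness_mulZl witness_mulZr.

Lemma witness_mulA (u v w : witness) : u ** (v ** w) = (u ** v) ** w.
Proof.
case: u v w => [[[[[a b] c] d] e] f] [[[[[a1 b1] c1] d1] e1] f1].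
move=> [[[[[a2 b2] c2] d2] e2] f2]; rewrite /amul /= /witness_mul.
by do !congr pair; ring.
Qed.

HB.instance Definition _ := LinAlg_isAlternative.Build k witness
  (fun u v => esym (witness_mulA u u v)) (fun u v => witness_mulA v u u).

(** A square [v ** v] has no [y] or [x] coordinate and equal [xy] and [yx] coordinates, so the two
    remaining terms in [yyx] cancel. *)
Lemma witness_mul_sqr (u v : witness) : u ** (v ** v) = 0.
Proof.
case: u v => [[[[[a b] c] d] e] f] [[[[[a1 b1] c1] d1] e1] f1].
rewrite /amul /= /witness_mul -[RHS]/((0, 0, 0, 0, 0, 0) : witness).
by do !congr pair; ring.
Qed.

Lemma witness_sqr_mul_neq0 : exists u v : witness, (v ** v) ** u <> 0.
Proof.
(* Here [u] is [x] and [v] is [y]; the product is the basis vector [yyx], read off by [snd]. *)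
exists (0, 1, 0, 0, 0, 0), (1, 0, 0, 0, 0, 0) => /(congr1 snd) /= /eqP.
by rewrite !(mulr1, mul0r, mulr0, subr0, addr0) oner_eq0.
Qed.

End Witness.

Section KernelIdeal.
Variables (k : fieldType) (A B : linAlgType k) (f : linAlgHom A B).
Local Open Scope ring_scope.

Definition ker_pred : {pred A} := fun x => f x == 0.

Lemma ker_pred_ideal : two_sided_ideal ker_pred.
Proof.
have amul0r (b : B) : (0 : B) ** b = 0 by rewrite -(subrr b) amulBl !subrr.
have amulr0 (b : B) : b ** (0 : B) = 0 by rewrite -(subrr b) amulBr !subrr.
have inE x : (x \in ker_pred) = (f x == 0) by [].
split=> [|a x|a x]; first split=> [|c x y].
- by rewrite inE raddf0.
- by rewrite !inE linearP /= => /eqP -> /eqP ->; rewrite scaler0 addr0.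
- by rewrite !inE hom_amul => /eqP ->; rewrite amulr0.
- by rewrite !inE hom_amul => /eqP ->; rewrite amul0r.
Qed.

Definition ker_ideal : linAlgIdeal A := LinAlgIdeal ker_pred_ideal.

End KernelIdeal.

Section FreeOnTwo.
Variables (k : fieldType) (A : altAlgType k) (a b : A).
Local Open Scope ring_scope.

Definition lift12 : linAlgHom (FX k X12) A :=
  free_lift (fun i : X12 => if val i == 0%N then a else b).

Lemma lift12_x1 : lift12 (x1 k) = a.
Proof. exact: free_lift_gen. Qed.

Lemma lift12_x2 : lift12 (x2 k) = b.
Proof. exact: free_lift_gen. Qed.

End FreeOnTwo.

Section Verbal.
Variable k : fieldType.
Local Open Scope ring_scope.

(** The endomorphism of the free algebra sending the generators to representatives of [u] and [v]
    makes the product a generator of the verbal ideal. *)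
Lemma algH_mul_sqr (u v : algH k) : u ** (v ** v) = 0.
Proof.
rewrite -(quot_reprK u) -(quot_reprK v).
move: (quot_repr u) (quot_repr v) => a b; rewrite -(quot_piM _ b b) -quot_piM.
rewrite -(raddf0 (quot_pi (verbalI k))); apply/quot_pi_eq; rewrite subr0.
apply: sub_ideal_gen; exists (lift12 a b) => //.
by rewrite !hom_amul lift12_x1 lift12_x2.
Qed.

(** The kernel of [f] is an ideal, and it contains each generator because [f] sends it to some
    [u ** (v ** v)] in [A]. *)
Lemma verbalI_hom0 (A : altAlgType k) (f : linAlgHom (FX k X12) A) w :
  (forall u v : A, u ** (v ** v) = 0) -> w \in verbalI k -> f w = 0.
Proof.
move=> A0 /ideal_gen_predP /(_ (ker_ideal f)) wI; apply/eqP/wI.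
by move=> _ [alpha _ <-]; apply/eqP; rewrite !hom_amul A0.
Qed.

Lemma sqr_mul_notin_verbalI : (x2 k ** x2 k) ** x1 k \notin verbalI k.
Proof.
have [u [v uv]] := witness_sqr_mul_neq0 k.
apply/negP => /(verbalI_hom0 (lift12 u v) (@witness_mul_sqr k)).
by rewrite !hom_amul lift12_x1 lift12_x2.
Qed.

End Verbal.

Theorem proposition5p5 (k : fieldType) (char0 : [pchar k]%R =i pred0) :
  ~ geom_equiv (algH k) (oppalg (algH k)).
Proof.
(* The closure of the empty set is the intersection of all kernels, that is, the identities in two
   variables. *)
move=> /(_ X12 set0) equiv.
have : galois_closure (algH k) set0 (x1 k ** (x2 k ** x2 k))%R.
  by move=> mu _; rewrite /hker /= !hom_amul algH_mul_sqr.
(* Test on the homomorphism to the opposite algebra that sends each generator to its class. *)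
rewrite equiv => /(_ (@lift12 k (oppalg (algH k))
  (quot_pi (verbalI k) (x1 k)) (quot_pi (verbalI k) (x2 k)))).
move=> /(_ (@sub0set _ _)).
rewrite /hker /= !hom_amul lift12_x1 lift12_x2.
(* Unfolding the reversed product, [sqr0] says that the class of [(x2 ** x2) ** x1] is zero in
   [algH k]. *)
move=> sqr0; apply: (negP (sqr_mul_notin_verbalI k)).
rewrite -[(_ ** x1 k)%R]subr0; apply/quot_pi_eq.
by rewrite !quot_piM raddf0.
Qed.
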